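(* Let $(X_n,\|\cdot\|_n)_{n\ge 1}$ be a sequence of finite dimensional real Banach spaces, each having a $1$-unconditional basis, and let $(X,\|\cdot\|)$ be the Banach space constructed from them as described in the context. Then $X$ does not contain an equilateral sequence, i.e. there is no sequence $(y_m)_{m\ge1}$ in $X$ and constant $\lambda>0$ with $\|y_m-y_k\|=\lambda$ for all $m\neq k$.
   Context: For a sequence $(X_n,\|\cdot\|_n)_{n\ge1}$ of Banach spaces, let $c_{00}((X_n))$ be the vector space of sequences $(x_1,x_2,\dots)$ with $x_k\in X_k$ and only finitely many $x_k\neq 0$; write $(x_1,\dots,x_n)$ for $(x_1,\dots,x_n,0,0,\dots)$. Define a norm on $c_{00}((X_n))$ inductively: $\|(x_1)\|=\|x_1\|_1$ (the norm of $X_1$), and for $n\ge 2$, $$\|(x_1,\dots,x_n)\|=\Big(1-\tfrac{1}{n+1}\Big)\big(\|x_n\|_n+\|(x_1,\dots,x_{n-1})\|\big)+\tfrac{1}{n+1}\max\Big\{\tfrac{\|x_n\|_n}{n},\ \|(x_1,\dots,x_{n-1})\|\Big\}.$$ $(X,\|\cdot\|)$ is the completion of $(c_{00}((X_n)),\|\cdot\|)$. A $1$-unconditional basis $(e_j)$ of a finite dimensional space is a basis with $\|\sum \varepsilon_j a_j e_j\|=\|\sum a_je_j\|$ for all scalars $a_j$ and signs $\varepsilon_j\in\{-1,1\}$. *)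

(* Defs.v *)
From HB Require Import structures.
From mathcomp Require Import all_boot all_order all_algebra.
From mathcomp Require Import all_classical all_reals all_analysis.
Set Implicit Arguments. Unset Strict Implicit. Unset Printing Implicit Defensive.
Import Order.TTheory GRing.Theory Num.Theory.
Import numFieldNormedType.Exports.
Local Open Scope ring_scope.

Definition is_norm (R : realType) (d : nat) (N : 'rV[R]_d -> R) : Prop :=
  (forall x y, N (x + y) <= N x + N y) /\
  (forall (a : R) x, N (a *: x) = `|a| * N x) /\
  (forall x, N x = 0 -> x = 0).

Definition std_basis_1_unconditional (R : realType) (d : nat)
  (N : 'rV[R]_d -> R) : Prop :=
  forall (eps : 'I_d -> bool) (x : 'rV[R]_d),
    N (\row_j ((-1) ^+ eps j * x 0 j)) = N x.

(* Spaces are indexed from 0: space k of the Rocq sequence is X_{k+1} of the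
   paper.  tnorm N x m is the paper's norm ||(x_1,...,x_m)|| of the truncation
   of x to its first m components (tnorm N x 0 = 0, the empty sequence). *)
Fixpoint tnorm (R : realType) (d : nat -> nat) (N : forall n, 'rV[R]_(d n) -> R)
  (x : forall n, 'rV[R]_(d n)) (m : nat) : R :=
  match m with
  | 0 => 0
  | m'.+1 =>
      if m' is 0 then N 0%N (x 0%N)
      else
        let a := N m' (x m') in
        let t := tnorm N x m' in
        (1 - 1 / (m'.+2)%:R) * (a + t)
        + 1 / (m'.+2)%:R * Num.max (a / (m'.+1)%:R) t
  end.

(* Main.v *)
(** A coordinatewise limit along a nonprincipal ultrafilter exists for every
bounded sequence, and far out the norm behaves like an l^1-sum.  So if [Y i] were
equilateral with constant [lam] and [x] its coordinatewise limit, then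
[z i = Y i - x] would satisfy [|z i| = lam / 2] for all [i], that is
[|z i - z k| = |z i| + |z k|].  This additivity propagates to all truncations
(see [defect]) and has two consequences.  In each coordinate [n] it gives
[N n (z i n - z k n) = N n (z i n) + N n (z k n)], so that normalising the nonzero
[z i n] would produce a 2-separated sequence in a finite-dimensional ball; hence
each coordinate of [z i] vanishes for almost all [i].  On the other hand the
maximum in the definition of the norm must be attained on the same side for [z i]
and [z k].  For [z 0] it is eventually the second term, say from [n0] on, so that
[z i] cannot have its first nonzero coordinate beyond [n0]; but for almost all [i]
the coordinates before [n0] vanish. *)

Require Import Defs.
From HB Require Import structures.
From mathcomp Require Import all_boot all_order all_algebra.
From mathcomp Require Import all_classical all_reals all_analysis.
From mathcomp Require Import ring lra.
Import Order.TTheory GRing.Theory Num.Theory.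
Import numFieldNormedType.Exports.
Local Open Scope ring_scope.

(** * Norms on a single finite-dimensional space *)

Section Norm.
Context {R : realType} {d : nat} {N : 'rV[R]_d -> R}.
Hypothesis normN : is_norm N.

Lemma is_norm0 : N 0 = 0.
Proof. by case: normN => _ [/(_ 0 0)]; rewrite scale0r normr0 mul0r. Qed.

Lemma is_norm_opp x : N (- x) = N x.
Proof.
by case: normN => _ [/(_ (-1) x)]; rewrite scaleN1r normrN normr1 mul1r.
Qed.

Lemma is_norm_ge0 x : 0 <= N x.
Proof.
case: normN => /(_ x (- x)); rewrite subrr is_norm0 is_norm_opp => + _; lra.
Qed.

Lemma is_norm_distrC x y : N (x - y) = N (y - x).
Proof. by rewrite -is_norm_opp opprB. Qed.

Lemma is_norm_sub x y : N (x - y) <= N x + N y.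
Proof. by case: normN => /(_ x (- y)) + _; rewrite is_norm_opp. Qed.

Lemma is_norm_triangle z x y : N (x - y) <= N (x - z) + N (y - z).
Proof. by rewrite -(is_norm_distrC z y) -{1}(subrK z x) -addrA; case: normN. Qed.

Lemma is_norm_le_add_diff x y : N x <= N y + N (x - y).
Proof. by rewrite -{1}(subrK y x) addrC; case: normN. Qed.

Lemma is_norm_sum n (f : 'I_n -> 'rV[R]_d) :
  N (\sum_(k < n) f k) <= \sum_(k < n) N (f k).
Proof.
elim/big_ind2: _ => //; first by rewrite is_norm0.
move=> x a y b xa yb; case: normN => tri _; exact: le_trans (tri _ _) (lerD xa yb).
Qed.

Hypothesis uncN : std_basis_1_unconditional N.

Lemma unconditional_coord_le (x : 'rV[R]_d) (k : 'I_d) :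
  `|x 0 k| * N (delta_mx 0 k) <= N x.
Proof.
case: normN => tri [hom _].
(* [x 0 k *: e_k] is the average of [x] and of its image under the sign change
   that fixes only the [k]-th coordinate *)
have := tri x (\row_j ((-1) ^+ (j != k) * x 0 j)); rewrite (uncN (fun j => j != k)).
suff -> : x + \row_j ((-1) ^+ (j != k) * x 0 j) = (2 * x 0 k) *: delta_mx 0 k.
  by rewrite hom normrM ger0_norm // -mulrA; lra.
apply/rowP => j; rewrite !mxE eqxx /=; case: eqVneq => [->|_] /=; ring.
Qed.

End Norm.

(** * Limits of bounded families along an ultrafilter *)

Section Ultra.
Local Open Scope classical_set_scope.
Context {R : realType} {T : Type} {U : set_system T}.
Hypothesis ultraU : UltraFilter U.

(** Compactness of [[-C, C]] gives a cluster point of [u] along [U], and for an ultrafilter a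
    cluster point is a limit. *)
Lemma ultra_bounded_cvg {u : T -> R} {C : R} : (forall i, `|u i| <= C) ->
  exists l, forall e : R, 0 < e -> \forall i \near U, `|u i - l| < e.
Proof.
move=> uC; have UP : ProperFilter U by exact: ultra_proper.
have [|l [_ cl]] := @segment_compact R (- C) C (u @ U) _.
  by apply: nearW => i; rewrite /= in_itv /= -ler_norml; apply: uC.
exists l => e e0.
have [//|nU] := in_ultra_setVsetC [set i | `|u i - l| < e] ultraU.
have [|_ [/= [i /= ui <-]]] := cl (u @` ~` [set i | `|u i - l| < e]) _ _
    (nbhsx_ballx l e e0).
  by apply: (@filterS _ U _ _ _ _ nU) => i ui; exists i.
by rewrite /ball /= distrC.
Qed.

Lemma ultra_bounded_cvg_row {d : nat} {N : 'rV[R]_d -> R} {u : T -> 'rV[R]_d}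
    {C : R} :
  is_norm N -> std_basis_1_unconditional N -> (forall i, N (u i) <= C) ->
  exists x, forall e : R, 0 < e -> \forall i \near U, N (u i - x) < e.
Proof.
move=> nN uN uC; have UP : ProperFilter U by exact: ultra_proper.
pose b k := N (delta_mx 0 k).
have b0 k : 0 < b k.
  rewrite lt_def is_norm_ge0 // andbT; apply/eqP => bk0.
  case: nN => _ [_ /(_ _ bk0)] /matrixP /(_ 0 k); rewrite !mxE !eqxx /=.
  by move/eqP; rewrite oner_eq0.
have /choice[l ul] : forall k, exists l, forall e : R, 0 < e ->
    \forall i \near U, `|u i 0 k - l| < e.
  move=> k; apply: (@ultra_bounded_cvg (fun i => u i 0 k) (C / b k)) => i.
  by rewrite ler_pdivlMr //; apply: le_trans (uC i); apply: unconditional_coord_le.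
exists (\row_k l k) => e e0.
(* Each of the [d] basis terms will have norm at most [e / d.+1]; dividing by [d.+1] makes the total
   strictly less than [e] and also covers [d = 0]. *)
have : \forall i \near U, forall k, `|u i 0 k - l k| < e / (d.+1%:R * b k).
  by apply: filter_forall => k; apply: ul; rewrite divr_gt0 // mulr_gt0.
apply: filterS => i ui.
have -> : u i - \row_k l k = \sum_k (u i 0 k - l k) *: delta_mx 0 k.
  by rewrite {1}(row_sum_delta (u i - _)); apply: eq_bigr => k _; rewrite !mxE.
apply: (le_lt_trans (is_norm_sum nN _ _)).
apply: (@le_lt_trans _ _ (\sum_(k < d) e / d.+1%:R)).
  apply: ler_sum => k _; case: (nN) => _ [-> _].
  by rewrite -(ler_pdivlMr _ _ (b0 k)) -[leRHS]mulrA -invfM; apply/ltW/ui.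
rewrite sumr_const card_ord -[ltLHS]mulr_natl mulrCA gtr_pMr //.
by rewrite ltr_pdivrMr // mul1r ltr_nat.
Qed.
End Ultra.

(** * The truncated norms and the defect in their triangle inequality *)

Section TruncatedNorm.
Local Open Scope classical_set_scope.
Context {R : realType} {d : nat -> nat} {N : forall n, 'rV[R]_(d n) -> R}.
Hypothesis normN : forall n, is_norm (N n).

Local Notation sequences := (forall n, 'rV[R]_(d n)).
Local Notation "x \-- y" := (fun n => x n - y n) (at level 50).
Local Notation F := (tnorm N).
Implicit Types (x y z : sequences) (m : nat).

(** The separate first clause of [tnorm] fits the general recursion: for [m = 0] the right-hand side
    is [a / 2 + Num.max a 0 / 2 = a], where [a = N 0 (x 0)]. *)
Lemma tnormS x m :
  F x m.+1 = (1 - m.+2%:R^-1) * (N m (x m) + F x m) +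
             m.+2%:R^-1 * Num.max (N m (x m) / m.+1%:R) (F x m).
Proof.
have a0 := is_norm_ge0 (normN m) (x m).
case: m a0 => [a0|m _] /=; last by rewrite !div1r.
by rewrite divr1 max_l //; field.
Qed.

Lemma invS_bounds m : 0 < (m.+2%:R^-1 : R) <= 2^-1.
Proof. by rewrite invr_gt0 ltr0n lef_pV2 ?posrE ?ltr0n // ler_nat. Qed.

Lemma coord_div_le x m : N m (x m) / m.+1%:R <= N m (x m).
Proof. by rewrite ler_pdivrMr // ler_peMr ?is_norm_ge0 // ler1n. Qed.

Lemma tnorm_ge0 x m : 0 <= F x m.
Proof.
elim: m => [//|m IH]; rewrite tnormS.
move: (m.+2%:R^-1) (invS_bounds m) => q /andP[q0 q1].
have : F x m <= Num.max (N m (x m) / m.+1%:R) (F x m) by rewrite le_max lexx orbT.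
by have := is_norm_ge0 (normN m) (x m); nra.
Qed.

Lemma tnormS_ge x m : F x m + (1 - m.+2%:R^-1) * N m (x m) <= F x m.+1.
Proof.
rewrite tnormS; move: (m.+2%:R^-1) (invS_bounds m) => q /andP[q0 q1].
have : F x m <= Num.max (N m (x m) / m.+1%:R) (F x m) by rewrite le_max lexx orbT.
nra.
Qed.

Lemma tnormS_le x m : F x m.+1 <= F x m + N m (x m).
Proof.
rewrite tnormS; move: (m.+2%:R^-1) (invS_bounds m) => q /andP[q0 q1].
have : Num.max (N m (x m) / m.+1%:R) (F x m) <= F x m + N m (x m).
  rewrite ge_max lerDl is_norm_ge0 // andbT.
  by apply: le_trans (coord_div_le x m) _; rewrite lerDr tnorm_ge0.
nra.
Qed.

Lemma coord_le_tnormS x m : N m (x m) <= 2 * (F x m.+1 - F x m).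
Proof.
have := tnormS_ge x m; move: (m.+2%:R^-1) (invS_bounds m) => q /andP[q0 q1].
have := is_norm_ge0 (normN m) (x m); nra.
Qed.

Lemma tnorm_nondecreasing x : nondecreasing_seq (F x).
Proof.
apply/nondecreasing_seqP => m.
by have := coord_le_tnormS x m; have := is_norm_ge0 (normN m) (x m); lra.
Qed.

Lemma coord_le_tnorm x m n : (m < n)%N -> N m (x m) <= 2 * F x n.
Proof.
move=> mn; have := coord_le_tnormS x m; have := tnorm_ge0 x m.
have := tnorm_nondecreasing x _ _ mn; lra.
Qed.

Lemma tnorm_sum_le x m : F x m <= \sum_(k < m) N k (x k).
Proof.
elim: m => [|m IH]; first by rewrite big_ord0.
by rewrite big_ord_recr /=; apply: le_trans (tnormS_le x m) _; rewrite lerD2r.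
Qed.

Definition defect x y m : R := F x m + F y m - F (x \-- y) m.

(** The defect at [m] is assumed nonnegative because the induction for [defect_ge0] relies on this
    bound. *)
Lemma max_sub_le x y m : 0 <= defect x y m ->
  Num.max (N m (x m - y m) / m.+1%:R) (F (x \-- y) m) <=
  Num.max (N m (x m) / m.+1%:R) (F x m) + Num.max (N m (y m) / m.+1%:R) (F y m).
Proof.
rewrite /defect subr_ge0 => D0; rewrite ge_max; apply/andP; split.
  apply: (@le_trans _ _ (N m (x m) / m.+1%:R + N m (y m) / m.+1%:R)).
    by rewrite -mulrDl ler_wpM2r // is_norm_sub.
  by rewrite lerD // le_max lexx.
by apply: (le_trans D0); rewrite lerD // le_max lexx orbT.
Qed.

Lemma defect_ge0 x y m : 0 <= defect x y m.
Proof.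
elim: m => [|m D0]; first by rewrite /defect /= addr0 subr0.
move: (D0) (max_sub_le _ _ _ D0); rewrite /defect !tnormS.
move: (m.+2%:R^-1) (invS_bounds m) => q /andP[q0 q1].
have := is_norm_sub (normN m) (x m) (y m); nra.
Qed.

(** The coordinate [m] and the maxima contribute nonnegative amounts. Since the factor is at least
    [1/2], a positive defect stays positive, though it might still decay. *)
Lemma defectS_ge x y m : (1 - m.+2%:R^-1) * defect x y m <= defect x y m.+1.
Proof.
move: (max_sub_le _ _ _ (defect_ge0 x y m)); rewrite /defect !tnormS.
move: (m.+2%:R^-1) (invS_bounds m) => q /andP[q0 q1].
have := is_norm_sub (normN m) (x m) (y m); nra.
Qed.

(** When the maximum for the difference is its second term, that term also carries the old defect,
    with weight [q], which restores the full coefficient [1] and excludes decay. *)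
Lemma defectS_ge_of_small x y m : N m (x m - y m) / m.+1%:R <= F (x \-- y) m ->
  defect x y m <= defect x y m.+1.
Proof.
move=> small; rewrite /defect !tnormS (max_r small).
move: (m.+2%:R^-1) (invS_bounds m) => q /andP[q0 q1].
have := is_norm_sub (normN m) (x m) (y m).
have : F x m <= Num.max (N m (x m) / m.+1%:R) (F x m) by rewrite le_max lexx orbT.
have : F y m <= Num.max (N m (y m) / m.+1%:R) (F y m) by rewrite le_max lexx orbT.
nra.
Qed.

(** The defect at [m.+1] is a combination, with positive weights, of the defect at [m], the defect
    of [N m] and that of the maxima. All are nonnegative, so all vanish. *)
Lemma defect_eq0_coord x y m : (forall n, defect x y n = 0) ->
  N m (x m - y m) = N m (x m) + N m (y m).
Proof.
move=> D0; move: (D0 m) (D0 m.+1) (max_sub_le _ _ _ (defect_ge0 x y m)).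
rewrite /defect !tnormS.
move: (m.+2%:R^-1) (invS_bounds m) => q /andP[q0 q1].
have := is_norm_sub (normN m) (x m) (y m).
move=> cab Dm Dm1 M; apply/le_anti; rewrite cab /=; nra.
Qed.

Lemma defect_eq0_dominated x y m : (forall n, defect x y n = 0) ->
  N m (x m) / m.+1%:R < F x m -> N m (y m) / m.+1%:R <= F y m.
Proof.
move=> D0 xm; rewrite leNgt; apply/negP => ym.
have := D0 m.+1; have := D0 m; rewrite /defect !tnormS defect_eq0_coord //.
rewrite (max_r (ltW xm)) (max_l (ltW ym)) [(_ + _) / _]mulrDl.
move: (m.+2%:R^-1) (invS_bounds m) => q /andP[q0 q1].
set X := N m (x m) / m.+1%:R in xm *; set Y := N m (y m) / m.+1%:R in ym *.
(* Here [X < F x m] and [F y m < Y], so both [X + Y] and [F x m + F y m] lie strictly below the sum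
   [F x m + Y] of the two maxima, and the defect at [m.+1] would be positive. *)
move=> Dm Dm1; have : Num.max (X + Y) (F (x \-- y) m) < F x m + Y.
  by rewrite gt_max; lra.
rewrite -subr_gt0 -(pmulr_rgt0 _ q0) => M.
nra.
Qed.

Lemma tnorm_sub x y m : F (x \-- y) m <= F x m + F y m.
Proof. by have := defect_ge0 x y m; rewrite /defect; lra. Qed.

Lemma tnorm_distrC x y m : F (x \-- y) m = F (y \-- x) m.
Proof. by elim: m => // m IH; rewrite !tnormS IH is_norm_distrC. Qed.

Lemma tnorm_triangle z x y m : F (x \-- y) m <= F (x \-- z) m + F (y \-- z) m.
Proof.
suff -> : x \-- y = (x \-- z) \-- (y \-- z) by apply: tnorm_sub.
by apply: functional_extensionality_dep => n; rewrite opprB addrA subrK.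
Qed.

Lemma tnorm_le_add x y m : F x m <= F y m + F (x \-- y) m.
Proof.
elim: m => [|m IH]; first by rewrite /= addr0.
have {1}-> : x = (x \-- y) \-- (fun n => - y n).
  by apply: functional_extensionality_dep => n; rewrite opprK subrK.
apply: le_trans (tnorm_sub _ _ _) _; rewrite addrC lerD2r.
suff -> : F (fun n => - y n) m.+1 = F y m.+1 by [].
by elim: {IH}m.+1 => // k IH; rewrite !tnormS IH is_norm_opp.
Qed.

(* Far out the norm behaves like an l^1-sum, so that [y] adds up with the part
   of [x] outside the first [M] coordinates. *)
Lemma defect_le x y M m : (M <= m)%N ->
  defect x y m <= 2 * F y M + 4 * (F x m - F x M) + 2 / M.+2%:R * F y m.
Proof.
elim: m => [|m IH].
  by rewrite leqn0 => /eqP ->; rewrite /defect /=; lra.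
rewrite leq_eqVlt => /orP[/eqP <-|Mm].
  have := tnorm_le_add x y M.
  have : 0 <= 2 / M.+2%:R * F y M by rewrite mulr_ge0 ?tnorm_ge0.
  by rewrite /defect; move: (_ / _) => p; lra.
have q1 : m.+2%:R^-1 <= M.+2%:R^-1 :> R.
  by rewrite lef_pV2 ?posrE ?ltr0n // ler_nat !ltnS.
move: (IH Mm); have := coord_le_tnormS x m; have := coord_le_tnormS y m.
have := is_norm_le_add_diff (normN m) (y m) (x m); rewrite is_norm_distrC //.
have := is_norm_ge0 (normN m) (y m); have := is_norm_ge0 (normN m) (x m).
move: (tnormS_le x m) (tnormS_le y m) (tnormS_ge (x \-- y) m) q1.
rewrite /defect; move: (m.+2%:R^-1) (invS_bounds m) => q /andP[q0 q2].
move: (M.+2%:R^-1) => p.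
set a := N m (x m); set b := N m (y m); set c := N m _.
move=> sa tb wc qp a0 b0 cab bt as_ IHm.
(* From [m] to [m.+1] the defect grows by at most [a + b - (1 - q) * c], hence by at most
   [2 * a + q * b]. Bounding [a] and [b] by twice the increments of [F x] and [F y] gives the
   constants [4] and [2]. *)
have : (1 - q) * (b - a) <= (1 - q) * c by rewrite ler_wpM2l //; lra.
have : q * b <= p * (2 * (F y m.+1 - F y m)).
  by apply: ler_pM => //; lra.
have : 0 <= q * a by rewrite mulr_ge0 // ltW.
lra.
Qed.
End TruncatedNorm.

Lemma nat_nonprincipal_ultrafilter :
  exists U : set_system nat, UltraFilter U /\
    forall n, \forall i \near U, (n <= i)%N.
Proof.
have [U [ultraU ooU]] := @ultraFilterLemma nat \oo%classic _.
by exists U; split => // n; apply: ooU; apply: nbhs_infty_ge.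
Qed.

(** * Pairs in one finite-dimensional space whose norms add up *)

Section AdditivePairs.
Context {R : realType} {d : nat} {N : 'rV[R]_d -> R}.
Hypothesis normN : is_norm N.

(** If [b <= a], then [a *: (x - y)], of norm [a * (N x + N y)], differs from [a *: x - b *: y] by a
    vector of norm [(a - b) * N y]. *)
Lemma norm_sub_scale (x y : 'rV[R]_d) (a b : R) : 0 <= a -> 0 <= b ->
  N (x - y) = N x + N y -> a * N x + b * N y <= N (a *: x - b *: y).
Proof.
case: (normN) => tri [hom _].
wlog ba : x y a b / b <= a => [W a0 b0 xy|a0 b0 xy].
  have [|/ltW ab] := leP b a; first by move=> ba; apply: W.
  rewrite addrC (is_norm_distrC normN); apply: W => //.
  by rewrite (is_norm_distrC normN) xy addrC.
have := tri (a *: x - b *: y) ((b - a) *: y).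
have -> : a *: x - b *: y + (b - a) *: y = a *: (x - y).
  by rewrite scalerBl addrA subrK scalerBr.
rewrite !hom xy ger0_norm // (@ler0_norm _ (b - a)); last by rewrite subr_le0.
lra.
Qed.

Lemma additive_pairs_near0 {U : set_system nat} {w : nat -> 'rV[R]_d} :
  UltraFilter U -> (forall n, \forall i \near U, (n <= i)%N) ->
  std_basis_1_unconditional N ->
  (forall i k, i <> k -> N (w i - w k) = N (w i) + N (w k)) ->
  \forall i \near U, w i = 0.
Proof.
move=> ultraU Uoo uncN wadd; have UP : ProperFilter U by exact: ultra_proper.
have [//|w0] := in_ultra_setVsetC [set i | w i = 0]%classic ultraU.
case: (normN) => _ [hom def].
pose v i := (N (w i))^-1 *: w i.
have v1 i : N (v i) <= 1.
  rewrite hom ger0_norm ?invr_ge0 ?is_norm_ge0 //.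
  by have [->|/mulVf ->] := eqVneq (N (w i)) 0; rewrite ?mulr0.
have [x vx] := ultra_bounded_cvg_row ultraU normN uncN v1.
have h0 : 0 < 2^-1 :> R by rewrite invr_gt0.
have [i [wi vi]] := filter_ex (filterI w0 (vx _ h0)).
(* Two distinct indices with [v i] and [v k] within [1/2] of [x] are at distance less than [1],
   whereas [norm_sub_scale] puts them at distance at least [2]. *)
have [k [[wk vk] ik]] := filter_ex (filterI (filterI w0 (vx _ h0)) (Uoo i.+1)).
have nwi : N (w i) != 0 by apply/eqP => /def.
have nwk : N (w k) != 0 by apply/eqP => /def.
have ki : i <> k by move=> e; rewrite e ltnn in ik.
have := @norm_sub_scale (w i) (w k) (N (w i))^-1 (N (w k))^-1 _ _ (wadd _ _ ki).
rewrite !invr_ge0 !is_norm_ge0 // !mulVf // => /(_ isT isT).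
by have := is_norm_triangle normN x (v i) (v k); move: vi vk; rewrite /= /v; lra.
Qed.
End AdditivePairs.

(** * Limits of truncated norms, and equilateral families of coordinate sequences *)

Section Equilateral.
Local Open Scope classical_set_scope.
Context {R : realType} {d : nat -> nat} {N : forall n, 'rV[R]_(d n) -> R}.
Hypothesis normN : forall n, is_norm (N n).
Local Notation sequences := (forall n, 'rV[R]_(d n)).
Local Notation "x \-- y" := (fun n => x n - y n) (at level 50).
Local Notation F := (tnorm N).

Lemma tnorm_cvg {x : sequences} {C : R} : (forall m, F x m <= C) ->
  exists2 g, F x @ \oo --> g & g <= C.
Proof.
move=> xC; have cF : cvgn (F x).
  apply: nondecreasing_is_cvgn; first exact: tnorm_nondecreasing.
  by exists C => _ [m _ <-].
by exists (limn (F x)) => //; apply: limr_le => //; apply: nearW.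
Qed.

Lemma tnorm_le_lim {x : sequences} {g : R} m : F x @ \oo --> g -> F x m <= g.
Proof.
move=> xg; rewrite -(cvg_lim _ xg) //.
apply: nondecreasing_cvgn_le; first exact: tnorm_nondecreasing.
by apply/cvg_ex; exists g.
Qed.

Lemma defect_cvg {x y : sequences} {g h l : R} : F x @ \oo --> g ->
  F y @ \oo --> h -> F (x \-- y) @ \oo --> l ->
  defect (N := N) x y @ \oo --> g + h - l.
Proof. by move=> xg yh xyl; apply: cvgB => //; apply: cvgD. Qed.

Lemma lim_tnorm_sub_le {x y : sequences} {g h l : R} : F x @ \oo --> g ->
  F y @ \oo --> h -> F (x \-- y) @ \oo --> l -> l <= g + h.
Proof.
move=> xg yh xyl; have Dlim := defect_cvg xg yh xyl.
rewrite -subr_ge0 -(cvg_lim _ Dlim) //; apply: limr_ge; first exact: cvgP Dlim.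
by apply: nearW => m; apply: defect_ge0.
Qed.

(** Coordinates have norm at most [2 * g], so dividing by [m.+1 >= 4] leaves at most [g / 2], which
    [F x m] eventually exceeds. *)
Lemma tnorm_dominates {x : sequences} {g : R} : 0 < g -> F x @ \oo --> g ->
  \forall m \near \oo, N m (x m) / m.+1%:R < F x m.
Proof.
move=> g0 xg; near=> m.
have : g / 2 < F x m.
  near: m; apply: cvgr_gt xg _ _; lra.
apply: le_lt_trans; rewrite ler_pdivrMr //.
apply: (le_trans (coord_le_tnorm normN x m m.+1 (ltnSn m))).
have := tnorm_le_lim m.+1 xg.
have : 4 <= m.+1%:R :> R by rewrite ler_nat; near: m; exact: (nbhs_infty_ge 3).
nra.
Unshelve. all: by end_near. Qed.

(** A positive defect would remain positive, and would be nondecreasing once [tnorm_dominates]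
    applies to the difference; but the defect tends to [0]. *)
Lemma additive_defect_eq0 {x y : sequences} {g h : R} : 0 < g + h ->
  F x @ \oo --> g -> F y @ \oo --> h -> F (x \-- y) @ \oo --> g + h ->
  forall n, defect (N := N) x y n = 0.
Proof.
move=> gh0 xg yh xygh n; apply/le_anti; rewrite defect_ge0 // andbT leNgt.
apply/negP => Dn.
have Dpos m : (n <= m)%N -> 0 < defect (N := N) x y m.
  elim: m => [|m IH]; first by rewrite leqn0 => /eqP <-.
  rewrite leq_eqVlt => /orP[/eqP <- //|/IH Dm].
  apply: lt_le_trans (defectS_ge normN x y m); rewrite mulr_gt0 //.
  by move: (m.+2%:R^-1) (@invS_bounds R m) => q /andP[q0 q1]; lra.
have [M _ Msmall] := tnorm_dominates gh0 xygh.
have Dmono m : (maxn n M <= m)%N ->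
    defect (N := N) x y (maxn n M) <= defect (N := N) x y m.
  elim: m => [|m IH]; first by rewrite leqn0 => /eqP ->.
  rewrite leq_eqVlt => /orP[/eqP -> //|nMm].
  apply: le_trans (IH nMm) _; apply: defectS_ge_of_small => //.
  by apply/ltW/Msmall; apply: leq_trans (leq_maxr n M) nMm.
have := defect_cvg xg yh xygh; rewrite subrr => Dlim.
have : \forall m \near \oo, defect (N := N) x y m < defect (N := N) x y (maxn n M).
  by apply: (cvgr_lt _ Dlim); apply/Dpos/leq_maxl.
case=> K _ /(_ (maxn K (maxn n M)) (leq_maxl _ _)) /=.
by rewrite ltNge Dmono // leq_maxr.
Qed.

Lemma tnorm_near0 {U : set_system nat} {z : nat -> sequences} : ProperFilter U ->
  (forall n (e : R), 0 < e -> \forall i \near U, N n (z i n) < e) ->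
  forall m (e : R), 0 < e -> \forall i \near U, F (z i) m < e.
Proof.
move=> UP z0; elim=> [|m IH] e e0; first exact: nearW.
have e20 : 0 < e / 2 by rewrite divr_gt0.
apply: filterS2 (IH _ e20) (z0 m _ e20) => i Fi zi.
by apply: le_lt_trans (tnormS_le normN _ _) _; lra.
Qed.

Lemma tnorm_asymptotically_additive {U : set_system nat} {x : sequences}
    {z : nat -> sequences} {g C : R} {h l : nat -> R} :
  UltraFilter U ->
  (forall n (e : R), 0 < e -> \forall i \near U, N n (z i n) < e) ->
  (forall i m, F (z i) m <= C) ->
  F x @ \oo --> g -> (forall i, F (z i) @ \oo --> h i) ->
  (\forall i \near U, F (x \-- z i) @ \oo --> l i) ->
  forall e : R, 0 < e -> \forall i \near U, g + h i - l i < e.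
Proof.
move=> ultraU z0 zC xg zh xzl e e0; have UP : ProperFilter U by exact: ultra_proper.
(* The uniform bound [C] allows one [M] for all [i]. Each of the three terms of [defect_le] is then
   at most [e / 4], once [F (z i) M < e / 8]. *)
have [M [xM CM]] : exists M, g - F x M < e / 16 /\ C / M.+2%:R < e / 8.
  near \oo => M; exists M; split; near: M.
    have : g - e / 16 < g by rewrite ltrBlDr ltrDl divr_gt0.
    by move/(cvgr_gt _ xg); apply: filterS => M; lra.
  have [K CK] : exists K : nat, C / (e / 8) <= K%:R.
    exists (Num.bound (C / (e / 8))); apply/ltW/archi_boundP.
    have C0 := le_trans (tnorm_ge0 normN (z 0%N) 0) (zC 0%N 0%N).
    by apply: divr_ge0 => //; apply/ltW; rewrite divr_gt0.
  near=> M; rewrite ltr_pdivrMr // mulrC -ltr_pdivrMr ?divr_gt0 //.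
  apply: (le_lt_trans CK); rewrite ltr_nat ltnS leqW //.
  by near: M; apply: nbhs_infty_ge.
have e80 : 0 < e / 8 by rewrite divr_gt0.
apply: filterS2 (tnorm_near0 UP z0 M _ e80) xzl => i ziM xzli.
apply: (@le_lt_trans _ _ (3 / 4 * e)); last by lra.
have Dlim := defect_cvg xg (zh i) xzli; rewrite -(cvg_lim _ Dlim) //.
apply: limr_le; first exact: cvgP Dlim.
exists M => // m /= Mm; apply: le_trans (defect_le normN _ _ _ _ Mm) _.
have := tnorm_le_lim m xg.
have : 2 / M.+2%:R * F (z i) m <= 2 * (C / M.+2%:R).
  by rewrite -mulrA ler_pM2l // mulrC ler_wpM2r.
move: (2 / M.+2%:R * _) (C / _) CM => p q; lra.
Unshelve. all: by end_near. Qed.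

Lemma no_equilateral_sequences (Y : nat -> sequences) (lam B : R) :
  (forall n, std_basis_1_unconditional (N n)) -> 0 < lam ->
  (forall i m, F (Y i) m <= B) ->
  (forall i k, i <> k -> F (Y i \-- Y k) @ \oo --> lam) -> False.
Proof.
move=> uncN lam0 YB Ylam.
have [U [ultraU Uoo]] := nat_nonprincipal_ultrafilter.
have UP : ProperFilter U by exact: ultra_proper.
have Une k : \forall i \near U, k <> i.
  by apply: filterS (Uoo k.+1) => i /[swap] ->; rewrite ltnn.
have Yx0 : forall n, exists x : 'rV[R]_(d n), forall e : R, 0 < e ->
    \forall i \near U, N n (Y i n - x) < e.
  move=> n; apply: (ultra_bounded_cvg_row ultraU (normN n) (uncN n)) => i.
  apply: le_trans (coord_le_tnorm normN (Y i) n n.+1 (ltnSn n)) _.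
  apply: (ler_wpM2l _ (YB i n.+1)); exact: ler0n.
pose x n := sval (cid (Yx0 n)).
have Yx n e : 0 < e -> \forall i \near U, N n (Y i n - x n) < e.
  exact: (svalP (cid (Yx0 n))).
pose z i := Y i \-- x.
have zY i k : z i \-- z k = Y i \-- Y k.
  apply: functional_extensionality_dep => n.
  by rewrite /z opprB addrA subrK.
(* For fixed [m], some [Y i] is within [1] of [x] in the [m]-th truncated norm. *)
have xB m : F x m <= B + 1.
  have [i] := filter_ex (tnorm_near0 UP Yx m 1 ltr01).
  have := tnorm_le_add normN x (Y i) m; have := YB i m.
  rewrite (tnorm_distrC normN) /z; lra.
have zB i m : F (z i) m <= B + (B + 1).
  by apply: le_trans (tnorm_sub normN _ _ _) _; rewrite lerD.
pose g i : R := limn (F (z i)).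
have zg i : F (z i) @ \oo --> g i.
  by have [h zh _] := tnorm_cvg (zB i); apply: cvgP zh.
have g_le i : `|g i| <= B + (B + 1).
  have [h zh hB] := tnorm_cvg (zB i); rewrite (cvg_unique _ (zg i) zh) //.
  by rewrite ger0_norm // (tnorm_le_lim 0 zh).
have zlam i k : i <> k -> F (z i \-- z k) @ \oo --> lam by rewrite zY; apply: Ylam.
have [L gL] := ultra_bounded_cvg ultraU g_le.
(* Letting [i] tend to infinity along [U] gives [lam = g k + L], where [L] is
   itself the limit of the [g k]; hence every [g k] is [lam / 2]. *)
have gLlam k : g k = lam - L.
  apply/le_anti/andP; split; apply/ler_addgt0Pr => e e0.
    have e20 : 0 < e / 2 by rewrite divr_gt0.
    have zklam : \forall i \near U, F (z k \-- z i) @ \oo --> lam.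
      by apply: filterS (Une k) => i; apply: zlam.
    have add := tnorm_asymptotically_additive (l := fun=> lam) ultraU Yx zB
      (zg k) zg zklam _ e20.
    have [i [gi Li]] := filter_ex (filterI add (gL _ e20)).
    by move: gi Li; rewrite /= ltr_norml; lra.
  have [i [Li ki]] := filter_ex (filterI (gL _ e0) (Une k)).
  have := lim_tnorm_sub_le (zg k) (zg i) (zlam _ _ ki).
  by move: Li; rewrite /= ltr_norml; lra.
(* The constant family [g k = lam - L] has limit [L] along [U]. *)
have L2 : L = lam / 2.
  apply/le_anti/andP; split; apply/ler_addgt0Pr => e e0;
    have [i] := filter_ex (gL _ e0); rewrite gLlam /= ltr_norml; lra.
have {gLlam L2} gE k : g k = lam / 2 by rewrite gLlam L2; lra.
have g0 : 0 < g 0%N by rewrite gE; lra.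
have D0 i k : i <> k -> forall n, defect (N := N) (z i) (z k) n = 0.
  have gik : g i + g k = lam by rewrite !gE; lra.
  move=> ik; apply: (additive_defect_eq0 _ (zg i) (zg k)); rewrite gik //.
  exact: zlam.
have z0 n : \forall i \near U, z i n = 0.
  apply: (additive_pairs_near0 (normN n) ultraU Uoo) => // i k /D0.
  exact: defect_eq0_coord.
have [n0 _ dom0] := tnorm_dominates g0 (zg 0%N).
have : \forall i \near U, forall n : 'I_n0, z i n = 0.
  by apply: filter_forall => n; exact: z0.
move=> /(filterI (Une 0%N))/filter_ex[i [i0 zi0]].
(* Once [F (z i) m = 0], domination by the second term of the maximum, inherited from [z 0], forces
   coordinate [m] of [z i] to vanish as well. *)
have Fzi m : (n0 <= m)%N -> F (z i) m = 0.
  elim: m => [//|m IH]; rewrite leq_eqVlt => /orP[/eqP <-|n0m].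
    apply/le_anti; rewrite tnorm_ge0 // andbT.
    apply: le_trans (tnorm_sum_le normN _ _) _.
    by rewrite big1 // => k _; rewrite zi0 is_norm0.
  apply/le_anti; rewrite tnorm_ge0 // andbT.
  apply: le_trans (tnormS_le normN _ _) _; rewrite IH // add0r.
  have := defect_eq0_dominated normN _ _ _ (D0 _ _ i0) (dom0 m n0m).
  by rewrite IH // pmulr_lle0.
have : F (z i) @ \oo --> (0 : R).
  by apply: cvg_near_cst; exists n0 => // m /= /Fzi ->.
by move=> /(cvg_unique _ (zg i)); rewrite gE => /(_ (@norm_hausdorff _ _)); lra.
Qed.

End Equilateral.

(** * Elements of the completion as coordinate sequences *)

Section Coordinates.
Local Open Scope classical_set_scope.
Context {R : realType} {d : nat -> nat} {N : forall n, 'rV[R]_(d n) -> R}.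
Context {V : completeNormedModType R} {j : forall n, {linear 'rV[R]_(d n) -> V}}.
Hypothesis normN : forall n, is_norm (N n).
Hypothesis uncN : forall n, std_basis_1_unconditional (N n).
Hypothesis iso : forall (x : forall n, 'rV[R]_(d n)) (m : nat),
  `| \sum_(k < m) j k (x k) | = tnorm N x m.
Hypothesis dense : forall (v : V) (e : R), 0 < e ->
  exists (x : forall n, 'rV[R]_(d n)) (m : nat),
    `| v - \sum_(k < m) j k (x k) | < e.

Local Notation sequences := (forall n, 'rV[R]_(d n)).
Local Notation "x \-- y" := (fun n => x n - y n) (at level 50).
Local Notation F := (tnorm N).
Local Notation S x m := (\sum_(k < m) j k (x k)).

Lemma norm_partial_sum_sub (x y : sequences) m :
  `|S x m - S y m| = F (x \-- y) m.
Proof.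
by rewrite -iso -sumrB; congr `|_|; apply: eq_bigr => k _; rewrite linearB.
Qed.

Lemma dense_eventually (v : V) (e : R) : 0 < e -> exists (x : sequences) (m0 : nat),
  forall m, (m0 <= m)%N -> `|v - S x m| < e.
Proof.
move=> /(dense v)[x [m0 vx]].
exists (fun n => if (n < m0)%N then x n else 0), m0 => m m0m.
suff -> : S (fun n => if (n < m0)%N then x n else 0) m = S x m0 by [].
rewrite (big_ord_widen m (fun k => j k (x k)) m0m) [RHS]big_mkcond /=.
by apply: eq_bigr => k _; case: ifP => // _; rewrite linear0.
Qed.

(** The coordinates are limits along [U] of those of finitely supported approximants [s i] of
    [v]. *)
Lemma coordinates_exist (v : V) :
  exists x : sequences, (fun m => S x m) @ \oo --> v.
Proof.
have [U [ultraU Uoo]] := nat_nonprincipal_ultrafilter.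
have UP : ProperFilter U by exact: ultra_proper.
have : forall i : nat, exists xm : sequences * nat,
    forall m, (xm.2 <= m)%N -> `|v - S xm.1 m| < i.+1%:R^-1.
  move=> i; have /(dense_eventually v)[x [m xm]] : 0 < i.+1%:R^-1 :> R.
    by rewrite invr_gt0.
  by exists (x, m).
move=> /choice[xm xmv]; pose s i := (xm i).1; pose M i := (xm i).2.
have sv i m : (M i <= m)%N -> `|v - S (s i) m| < i.+1%:R^-1 by apply: xmv.
have sB i m : F (s i) m <= `|v| + 1.
  have /sv vs := leq_maxr m (M i).
  apply: le_trans (tnorm_nondecreasing normN _ _ _ (leq_maxl m (M i))) _.
  rewrite -iso; have := ler_distD v (S (s i) (maxn m (M i))) 0.
  rewrite !subr0 distrC addrC => /le_trans; apply; rewrite lerD2l ltW //.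
  by apply: lt_le_trans vs _; rewrite invf_le1 // ler1n.
have x0 n : exists x : 'rV[R]_(d n), forall e : R, 0 < e ->
    \forall i \near U, N n (s i n - x) < e.
  apply: (ultra_bounded_cvg_row ultraU (normN n) (uncN n)) => i.
  apply: le_trans (coord_le_tnorm normN (s i) n n.+1 (ltnSn n)) _.
  apply: (ler_wpM2l _ (sB i n.+1)); exact: ler0n.
pose x n := sval (cid (x0 n)).
have sx n (e : R) : 0 < e -> \forall i \near U, N n (s i n - x n) < e.
  exact: (svalP (cid (x0 n))).
exists x; apply/cvgrPdist_lt => e e0.
have e40 : 0 < e / 4 by rewrite divr_gt0.
have [i0 i0e] : exists i0 : nat, forall i, (i0 <= i)%N -> i.+1%:R^-1 < e / 4.
  by have [i0 _ H] := near_infty_natSinv_lt (PosNum e40); exists i0.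
exists (M i0) => // m /= Mm.
have [i [si i0i]] := filter_ex (filterI
  (tnorm_near0 normN UP (z := fun i => s i \-- x) sx m _ e40) (Uoo i0)).
(* The index [i] depends on [m], but the bound does not: passing to the larger truncation
   [maxn m (M i)] compares both approximants with [v] itself. *)
have ss : F (s i0 \-- s i) m < e / 4 + e / 4.
  have mm : (m <= maxn m (M i))%N by apply: leq_maxl.
  apply: (le_lt_trans (tnorm_nondecreasing normN _ _ _ mm)).
  rewrite -norm_partial_sum_sub; apply: le_lt_trans (ler_distD v _ _) _.
  rewrite distrC; apply: ltrD.
    by apply: lt_trans (i0e _ (leqnn i0)); apply: sv; apply: leq_trans mm.
  by apply: lt_trans (i0e _ i0i); apply: sv; apply: leq_maxr.
have := ler_distD (S (s i0) m) v (S x m).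
rewrite norm_partial_sum_sub => /le_lt_trans; apply.
have := tnorm_triangle normN (s i) (s i0) x m.
rewrite (tnorm_distrC normN x).
have := lt_trans (sv _ _ Mm) (i0e _ (leqnn i0)).
move: si ss => /=; lra.
Qed.

End Coordinates.

(** The completion is given by its characterisation up to isometry: [V] is complete, and the maps
    [j n] embed the finitely supported sequences isometrically with dense image. *)
Theorem theorem2p2 (R : realType) (d : nat -> nat)
  (N : forall n, 'rV[R]_(d n) -> R)
  (HN : forall n, is_norm (N n))
  (HU : forall n, std_basis_1_unconditional (N n))
  (V : completeNormedModType R)
  (j : forall n, {linear 'rV[R]_(d n) -> V})
  (Hiso : forall (x : forall n, 'rV[R]_(d n)) (m : nat),
      `| \sum_(k < m) j k (x k) | = tnorm N x m)
  (Hdense : forall (v : V) (e : R), 0 < e ->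
      exists (x : forall n, 'rV[R]_(d n)) (m : nat),
        `| v - \sum_(k < m) j k (x k) | < e) :
  ~ (exists (y : nat -> V) (lam : R),
       0 < lam /\ forall m k : nat, m <> k -> `| y m - y k | = lam).
Proof.
case=> y [lam [lam0 ylam]].
have Y0 i := coordinates_exist HN HU Hiso Hdense (y i).
pose Y i := sval (cid (Y0 i)).
have Yy i : ((fun m => \sum_(k < m) j k (Y i k)) @ \oo --> y i)%classic.
  exact: (svalP (cid (Y0 i))).
have FY i : (tnorm N (Y i) @ \oo --> `|y i|)%classic.
  have -> : tnorm N (Y i) = (fun m => `|\sum_(k < m) j k (Y i k)|).
    by apply/funext => m; rewrite Hiso.
  exact: cvg_norm.
apply: (no_equilateral_sequences HN Y lam (`|y 0%N| + lam)) => //.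
  move=> i m; apply: le_trans (tnorm_le_lim HN m (FY i)) _.
  have [->|/eqP i0] := eqVneq i 0%N; first by rewrite lerDl ltW.
  by have := ler_distD (y 0%N) (y i) 0; rewrite !subr0 ylam // addrC.
move=> i k ik.
have -> : tnorm N (fun n => Y i n - Y k n) =
    (fun m => `|\sum_(l < m) j l (Y i l) - \sum_(l < m) j l (Y k l)|).
  by apply/funext => m; rewrite (norm_partial_sum_sub Hiso).
by rewrite -(ylam i k ik); apply: cvg_norm; apply: cvgB.
Qed.
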